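(* Let $c\ge 1$ be the number of labels, $f$ a base multi-label classifier, $1\le k'\le c$, $1\le k\le c$, $\sigma>0$, and $\mathbf{x}\in\mathbb{R}^m$. Let $L(\mathbf{x})=\{a_1,\dots,a_d\}\subseteq\{1,\dots,c\}$ be a set of $d\ge1$ labels. Suppose we are given numbers $\underline{p_{i}}\in[0,1]$ for $i\in L(\mathbf{x})$ with $\underline{p_i}\le p_i$, and numbers $\overline{p}_j\in[0,1]$ for $j\in\{1,\dots,c\}\setminus L(\mathbf{x})$ with $p_j\le\overline{p}_j$. Index so that $\underline{p_{a_1}}\ge\cdots\ge\underline{p_{a_d}}$, and let $b_1,\dots,b_{c-d}$ be an enumeration of $\{1,\dots,c\}\setminus L(\mathbf{x})$ with $\overline{p}_{b_1}\ge\overline{p}_{b_2}\ge\cdots\ge\overline{p}_{b_{c-d}}$ (ties broken arbitrarily); by convention $\overline{p}_{b_l}:=0$ for $l>c-d$. For $e'\in\{1,\dots,\min\{d,k\}\}$ set $\eta=d-e'+1$, $s=k-e'+1$, $\underline{p_{A_u}}=\sum_{l=e'}^{e'+u-1}\underline{p_{a_l}}$ for $1\le u\le\eta$, and $\overline{p}_{B_v}=\sum_{l=s-v+1}^{s}\overline{p}_{b_l}$ for $1\le v\le s$, and assume $\overline{p}_{B_v}\le k'$ for all such $v$. Let $R\ge 0$ and let $e$ be the largest $e'\in\{1,\dots,\min\{d,k\}\}$ satisfying $$\max\Big\{\Phi\big(\Phi^{-1}(\underline{p_{a_{e'}}})-\tfrac{R}{\sigma}\big),\ \max_{u=1}^{\eta}\tfrac{k'}{u}\,\Phi\big(\Phi^{-1}(\tfrac{\underline{p_{A_u}}}{k'})-\tfrac{R}{\sigma}\big)\Big\}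 > \min\Big\{\Phi\big(\Phi^{-1}(\overline{p}_{b_s})+\tfrac{R}{\sigma}\big),\ \min_{v=1}^{s}\tfrac{k'}{v}\,\Phi\big(\Phi^{-1}(\tfrac{\overline{p}_{B_v}}{k'})+\tfrac{R}{\sigma}\big)\Big\},$$ or $e=0$ if no such $e'$ exists. Then for every perturbation $\delta\in\mathbb{R}^m$ with $\|\delta\|_2\le R$, $$|L(\mathbf{x})\cap g_k(\mathbf{x}+\delta)|\ge e .$$
   Context: A base multi-label classifier $f$ with parameter $k'$ assigns to every input $\mathbf{w}\in\mathbb{R}^m$ a set $f_{k'}(\mathbf{w})\subseteq\{1,\dots,c\}$ of exactly $k'$ labels (measurably in $\mathbf{w}$). Let $\epsilon\sim\mathcal{N}(0,\sigma^2 I)$ be isotropic Gaussian noise. The label probability of label $i$ at input $\mathbf{x}$ is $p_i=\Pr(i\in f_{k'}(\mathbf{x}+\epsilon))$; in general, for any input $\mathbf{z}$, write $p_i(\mathbf{z})=\Pr(i\in f_{k'}(\mathbf{z}+\epsilon))$, so $p_i=p_i(\mathbf{x})$. The smoothed multi-label classifier $g$ outputs $g_k(\mathbf{z})$, the set of $k$ labels with the largest values of $p_i(\mathbf{z})$ (ties broken arbitrarily). $\Phi$ is the standard normal CDF and $\Phi^{-1}$ its inverse, with conventions $\Phi^{-1}(0)=-\infty$, $\Phi^{-1}(1)=+\infty$, $\Phi(-\infty)=0$, $\Phi(+\infty)=1$. *)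

(* Defs.v *)
From HB Require Import structures.
From mathcomp Require Import all_boot all_order all_algebra.
From mathcomp Require Import all_classical all_reals all_analysis.
Set Implicit Arguments.
Unset Strict Implicit.
Unset Printing Implicit Defensive.
Import Order.TTheory GRing.Theory Num.Theory.
Local Open Scope classical_set_scope.
Local Open Scope ring_scope.

(* Vectors of R^m are m-tuples of reals (equipped in MathComp-Analysis with the
   product sigma-algebra generated by the coordinate projections). *)
Definition vadd (R : realType) (m : nat) (z w : m.-tuple R) : m.-tuple R :=
  [tuple tnth z i + tnth w i | i < m].

Definition norm2 (R : realType) (m : nat) (w : m.-tuple R) : R :=
  Num.sqrt (\sum_(i < m) tnth w i ^+ 2).

(* Expectation of h(eps) for eps ~ N(0, sigma^2 I_m), written as the iterated
   integral over the m independent N(0, sigma^2) coordinates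
   (normal_prob 0 sigma has standard deviation sigma). *)
Fixpoint gauss_exp (R : realType) (sigma : R) (m : nat) :
    (m.-tuple R -> \bar R) -> \bar R :=
  match m return (m.-tuple R -> \bar R) -> \bar R with
  | 0 => fun h => h [tuple]
  | m'.+1 => fun h =>
      (\int[normal_prob 0 sigma]_t gauss_exp sigma (fun u => h (cons_tuple t u)))%E
  end.

Definition gauss_prob (R : realType) (sigma : R) (m : nat)
    (E : m.-tuple R -> bool) : R :=
  fine (gauss_exp sigma (fun e => ((E e)%:R)%:E)).

Definition label_prob (R : realType) (sigma : R) (m c : nat)
    (f : m.-tuple R -> {set 'I_c}) (z : m.-tuple R) (i : 'I_c) : R :=
  gauss_prob sigma (fun e => i \in f (vadd z e)).

(* G is a possible output g_k(z) of the smoothed classifier: a set of k labels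
   with the largest values of p_i(z), ties broken arbitrarily. *)
Definition is_topk (R : realType) (c : nat) (p : 'I_c -> R) (k : nat)
  (G : {set 'I_c}) : Prop :=
  #|G| = k /\ (forall i j, i \in G -> j \notin G -> p j <= p i).

Definition Phi (R : realType) (x : R) : R :=
  fine (normal_prob 0 1 `]-oo, x]).
Definition PhiE (R : realType) (x : \bar R) : R :=
  match x with
  | r%:E => Phi r
  | +oo%E => 1
  | -oo%E => 0
  end.
Definition PhiInv (R : realType) (p : R) : \bar R :=
  if p <= 0 then -oo%E
  else if 1 <= p then +oo%E
  else (inf [set x : R | p <= Phi x])%:E.

Section certified.
Variables (R : realType) (sigma rad : R) (kp k d : nat).
(* pa l = lower bound of p_{a_l}, pb l = upper bound of p_{b_l} (1-indexed),
   with pb l = 0 for l > c - d. *)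
Variables (pa pb : nat -> R).

Definition pA (e' u : nat) : R := \sum_(e' <= l < e' + u) pa l.
Definition pB (e' v : nat) : R :=
  let s := (k - e').+1 in \sum_((s - v).+1 <= l < s.+1) pb l.

Definition cert_cond (e' : nat) : bool :=
  let eta := (d - e').+1 in
  let s := (k - e').+1 in
  let kr : R := kp%:R in
  \big[Num.max/PhiE (PhiInv (pa e') - (rad / sigma)%:E)%E]_(1 <= u < eta.+1)
      (kr / u%:R * PhiE (PhiInv (pA e' u / kr) - (rad / sigma)%:E)%E)
  >
  \big[Num.min/PhiE (PhiInv (pb s) + (rad / sigma)%:E)%E]_(1 <= v < s.+1)
      (kr / v%:R * PhiE (PhiInv (pB e' v / kr) + (rad / sigma)%:E)%E).

Definition cert_e : nat :=
  (\max_(1 <= e' < (minn d k).+1 | cert_cond e') e')%N.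
End certified.

(* Main.v *)
Require Import Defs.
From HB Require Import structures.
From mathcomp Require Import all_boot all_order all_algebra.
From mathcomp Require Import all_classical all_reals all_analysis.
From mathcomp Require Import zify measurable_realfun ring lra.
Set Implicit Arguments.
Unset Strict Implicit.
Unset Printing Implicit Defensive.
Import Order.TTheory GRing.Theory Num.Theory.
Import numFieldNormedType.Exports.
Local Open Scope classical_set_scope.
Local Open Scope ring_scope.

(** Translating Gaussian noise by [d] reweights it by a likelihood ratio that
    increases with [<d, e>], so by the Neyman-Pearson argument a half-space
    orthogonal to [d] bounds from below how the mean of a [0, 1]-valued function
    [h] moves.  Since [<d, e>] has the law of [|d| N(0, sigma^2)], the mean of a
    half-space moves from [Phi q] to [Phi (q - |d| / sigma)].  Applying this to
    the translate of [h], with [-d], gives the upper bound.  Both are used for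
    [h w = #|S :&: f w| / k'] with [S] a set of labels, and for single labels.

    If fewer than [e'] labels of [L] are in [G], then at least [#|L| - e' + 1]
    labels of [L] are outside [G] and at least [k - e' + 1] labels of [G] are
    outside [L].  In the order of the given bounds, the [l]-th of the former has
    a lower bound at least that of [a_(e' + l - 1)] and the [l]-th of the latter
    an upper bound at most that of [b_l].  A number [tau] between the shifted
    probabilities outside [G] and those inside [G] therefore separates the two
    sides of the certificate, against its strict inequality. *)

Lemma indic_bool {R : pzRingType} (T : Type) (P : pred T) (x : T) :
  \1_[set y | P y] x = (P x)%:R :> R.
Proof.
by rewrite indicE; congr (nat_of_bool _)%:R; apply/idP/idP; rewrite inE.
Qed.

(** * One-dimensional normal laws *)

Lemma measure_integral_indic d (T : measurableType d) (R : realType)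
    (mu : {measure set T -> \bar R}) (A : set T) :
  measurable A -> mu A = (\int[mu]_x (\1_A x)%:E)%E.
Proof. by move=> mA; rewrite integral_indic// setIT. Qed.

Section normal_distribution.
Context {R : realType}.
Local Notation mu := (@lebesgue_measure R).
Local Open Scope ereal_scope.
Implicit Types (m s a b d t x z : R) (f : R -> \bar R).

Lemma measurable_affine a b :
  measurable_fun setT (fun x => (a * x + b)%R : measurableTypeR R).
Proof. by apply: measurable_funD => //; exact: measurable_funM. Qed.

(* The instance is named because [pushforward] also has a charge structure,
   which inference would choose. *)
Definition affine_lebesgue a b : {measure set (measurableTypeR R) -> \bar R} :=
  mscale (NngNum (normr_ge0 a))
    (measure_function_pushforward__canonical__measure_function_Measure mu
       (measurable_affine a b)).

Lemma affine_lebesgueE a b (A : set R) : a != 0%R -> measurable A ->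
  affine_lebesgue a b A = mu A.
Proof.
move=> a0 mA; wlog a_gt0 : a a0 / (0 < a)%R => [hwlog|].
  have [/(hwlog _ a0)//|a_lt0|a_eq0] := ltgtP 0%R a; last first.
    by rewrite -a_eq0 eqxx in a0.
  rewrite -(hwlog (- a)%R) ?oppr_eq0 ?oppr_gt0//.
  have mpreim : measurable ((fun x => - a * x + b)%R @^-1` A).
    by rewrite -[_ @^-1` _]setTI; exact: measurable_affine.
  rewrite /affine_lebesgue /= /mscale/= normrN; congr (_ * _).
  rewrite [RHS]/pushforward -(lebesgue_measureN mpreim) /pushforward.
  by congr (mu _); apply/seteqP; split=> x; rewrite /= mulNr mulrN opprK.
apply/esym/(lebesgue_measure_unique (mu := affine_lebesgue a b)) => //.
move=> _ [[x y] _ <-].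
have -> : affine_lebesgue a b `]x, y]%classic =
    `|a|%:E * mu `]((x - b) / a)%R, ((y - b) / a)%R]%classic.
  congr (_ * mu _); apply/seteqP; split => z; rewrite /= !in_itv/=;
    by rewrite ltr_pdivrMr// ler_pdivlMr// ltrBlDr lerBrDr (mulrC z).
rewrite !lebesgue_measure_itv/= !lte_fin ltr_pM2r ?invr_gt0// ltrD2r.
case: ifP => _; last by rewrite mule0.
by rewrite -!EFinB -EFinM gtr0_norm//; congr EFin; field; rewrite gt_eqF.
Qed.

Lemma ge0_integral_affine a b f : a != 0%R ->
  measurable_fun setT f -> (forall x, 0 <= f x) ->
  \int[mu]_x f x = `|a|%:E * \int[mu]_x f (a * x + b)%R.
Proof.
move=> a0 mf f0; rewrite (eq_measure_integral (affine_lebesgue a b))//.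
  rewrite ge0_integral_mscale// ge0_integral_pushforward//.
  exact: measurable_affine.
by move=> A mA _; exact/esym/affine_lebesgueE.
Qed.

Lemma measurable_normal_pdf_EFin m s :
  measurable_fun setT (EFin \o normal_pdf m s).
Proof. by apply/measurable_EFinP; exact: measurable_normal_pdf. Qed.

Lemma ge0_integral_normal_prob m s f :
  measurable_fun setT f -> (forall x, 0 <= f x) ->
  \int[normal_prob m s]_x f x = \int[mu]_x (f x * (normal_pdf m s x)%:E).
Proof.
move=> mf f0; have dom := normal_prob_dominates m s.
rewrite -(Radon_Nikodym_SigmaFinite.change_of_variables dom)//=.
have mpdf := measurable_normal_pdf_EFin m s.
have intRN := Radon_Nikodym_SigmaFinite.f_integrable dom.
apply: ae_eq_integral => //.
- by apply: emeasurable_funM => //; exact: measurable_int intRN.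
- exact: emeasurable_funM.
- apply: ae_eqe_mul2l => /=; apply: integral_ae_eq => //= E _ mE.
  by rewrite -Radon_Nikodym_SigmaFinite.f_integral.
Qed.

Lemma integral_normal_prob_cst m s (k : \bar R) : \int[normal_prob m s]_x k = k.
Proof. by rewrite integral_cst// [X in _ * X]integral_normal_pdf mule1. Qed.

Lemma normal_pdf_affine m s a b x : s != 0%R -> a != 0%R ->
  (`|a| * normal_pdf (a * m + b) (a * s) (a * x + b) = normal_pdf m s x)%R.
Proof.
move=> s0 a0; rewrite !normal_pdfE ?mulf_neq0// mulrA; congr (_ * _)%R.
  have peakE : ((a * s) ^+ 2 * pi *+ 2 = a ^+ 2 * (s ^+ 2 * pi *+ 2))%R by ring.
  rewrite /normal_peak peakE sqrtrM ?sqr_ge0// sqrtr_sqr.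
  by rewrite invfM mulVKf ?normr_eq0.
by rewrite /normal_fun; congr expR; field; rewrite s0 a0.
Qed.

Lemma ge0_integral_normal_prob_affine m s a b f : s != 0%R -> a != 0%R ->
  measurable_fun setT f -> (forall x, 0 <= f x) ->
  \int[normal_prob m s]_x f (a * x + b)%R =
  \int[normal_prob (a * m + b) (a * s)]_x f x.
Proof.
move=> s0 a0 mf f0.
have mfaffine := measurableT_comp mf (measurable_affine a b).
rewrite [LHS](ge0_integral_normal_prob m s mfaffine (fun=> f0 _)).
rewrite [RHS](ge0_integral_normal_prob _ _ mf f0).
rewrite [RHS](@ge0_integral_affine a b)//; last 2 first.
- by apply: emeasurable_funM => //; exact: measurable_normal_pdf_EFin.
- by move=> x; rewrite mule_ge0// lee_fin normal_pdf_ge0.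
rewrite -ge0_integralZl//; last 2 first.
- apply: emeasurable_funM => //.
  have mpdf := measurable_normal_pdf_EFin (a * m + b) (a * s).
  exact: measurableT_comp mpdf (measurable_affine a b).
- by move=> x _; rewrite mule_ge0// lee_fin normal_pdf_ge0.
apply: eq_integral => x _.
by rewrite -(normal_pdf_affine m b x s0 a0) EFinM muleCA.
Qed.

Lemma normal_prob_affine m s a b (A : set R) : s != 0%R -> a != 0%R ->
  measurable A ->
  normal_prob m s ((fun x => a * x + b)%R @^-1` A) =
  normal_prob (a * m + b) (a * s) A.
Proof.
move=> s0 a0 mA; pose f x : \bar R := (\1_A x)%:E.
have mf : measurable_fun setT f.
  by apply/measurable_EFinP; exact: measurable_indic.
have f0 x : 0 <= f x by rewrite lee_fin.
have mpreim : measurable ((fun x => a * x + b)%R @^-1` A).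
  by rewrite -[_ @^-1` _]setTI; exact: measurable_affine.
rewrite [LHS](measure_integral_indic (normal_prob m s) mpreim).
rewrite [RHS](measure_integral_indic (normal_prob _ _) mA).
exact: (ge0_integral_normal_prob_affine m b s0 a0 mf f0).
Qed.

Definition shift_density1 s d x : R :=
  expR (d * x / s ^+ 2 - d ^+ 2 / (2 * s ^+ 2)).

Lemma measurable_shift_density1 s d :
  measurable_fun setT (fun x => (shift_density1 s d x)%:E).
Proof.
apply/measurable_EFinP/measurableT_comp => //.
by apply: measurable_funB => //; apply: measurable_funM.
Qed.

Lemma normal_pdf_shift m s d x : s != 0%R ->
  (normal_pdf (m + d) s x = shift_density1 s d (x - m) * normal_pdf m s x)%R.
Proof.
move=> s0; rewrite !normal_pdfE// mulrCA; congr (_ * _)%R.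
by rewrite /normal_fun -expRD; congr expR; field.
Qed.

Lemma ge0_integral_normal_prob_shift m s d f : s != 0%R ->
  measurable_fun setT f -> (forall x, 0 <= f x) ->
  \int[normal_prob (m + d) s]_x f x =
  \int[normal_prob m s]_x ((shift_density1 s d (x - m))%:E * f x).
Proof.
move=> s0 mf f0.
have mwf : measurable_fun setT (fun x => (shift_density1 s d (x - m))%:E * f x).
  apply: emeasurable_funM => //.
  apply: (measurableT_comp (measurable_shift_density1 s d)).
  exact: measurable_funB.
have wf0 x : 0 <= (shift_density1 s d (x - m))%:E * f x.
  by rewrite mule_ge0// lee_fin expR_ge0.
rewrite [LHS](ge0_integral_normal_prob _ _ mf f0).
rewrite [RHS](ge0_integral_normal_prob _ _ mwf wf0).
by apply: eq_integral => x _; rewrite normal_pdf_shift// EFinM muleCA muleA.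
Qed.

(* Bayes' rule for a normal prior N(m, s^2) and a normal likelihood N(a x, t^2):
   joint density = marginal density of the observation * posterior density. *)
Lemma normal_pdf_bayes m s a t x z : s != 0%R -> t != 0%R ->
  let c := Num.sqrt ((a * s) ^+ 2 + t ^+ 2) in
  (normal_pdf (a * x) t z * normal_pdf m s x =
   normal_pdf (a * m) c z *
   normal_pdf ((m * t ^+ 2 + a * z * s ^+ 2) / c ^+ 2) (s * t / c) x)%R.
Proof.
move=> s0 t0 c.
have c2_gt0 : (0 < (a * s) ^+ 2 + t ^+ 2)%R.
  by rewrite ltr_wpDl ?sqr_ge0// exprn_even_gt0.
have c2E : (c ^+ 2 = (a * s) ^+ 2 + t ^+ 2)%R by rewrite sqr_sqrtr// ltW.
have c0 : c != 0%R by rewrite gt_eqF// sqrtr_gt0.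
rewrite !normal_pdfE ?mulf_neq0 ?invr_eq0// mulrACA [RHS]mulrACA.
congr (_ * _)%R.
- rewrite /normal_peak -!invfM -!sqrtrM; first last.
  + by rewrite mulrn_wge0// mulr_ge0 ?sqr_ge0 ?pi_ge0.
  + by rewrite mulrn_wge0// mulr_ge0 ?sqr_ge0 ?pi_ge0.
  congr ((Num.sqrt _)^-1)%R; field; exact: c0.
- rewrite /normal_fun -!expRD; congr expR.
  rewrite !exprMn exprVn c2E; field.
  by rewrite gt_eqF// t0 s0.
Qed.

Lemma measurable_normal_pdf_mean a t : t != 0%R ->
  measurable_fun setT (fun p : R * R => (normal_pdf (a * p.1) t p.2)%:E).
Proof.
move=> t0; apply/measurable_EFinP.
rewrite (_ : (fun p => _) = (fun p => normal_pdf 0 t (p.2 - a * p.1))%R).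
  apply: measurableT_comp; first exact: measurable_normal_pdf.
  by apply: measurable_funB => //; exact: measurable_funM.
by apply/funext => p; rewrite !normal_pdfE// /normal_fun subr0.
Qed.

Lemma integral_normal_pdf_marginal m s a t z : s != 0%R -> t != 0%R ->
  \int[normal_prob m s]_x (normal_pdf (a * x) t z)%:E =
  (normal_pdf (a * m) (Num.sqrt ((a * s) ^+ 2 + t ^+ 2)) z)%:E.
Proof.
move=> s0 t0.
have mpdf : measurable_fun setT (fun x => (normal_pdf (a * x) t z)%:E).
  have mpdf_mean := measurable_normal_pdf_mean a t0.
  exact: measurableT_comp mpdf_mean (measurable_pair2 _).
have pdf0 x : 0 <= (normal_pdf (a * x) t z)%:E.
  by rewrite lee_fin normal_pdf_ge0.
rewrite [LHS](ge0_integral_normal_prob _ _ mpdf pdf0).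
under eq_integral do rewrite -EFinM normal_pdf_bayes// EFinM.
rewrite ge0_integralZl ?lee_fin ?normal_pdf_ge0//.
- by rewrite integral_normal_pdf mule1.
- exact: measurable_normal_pdf_EFin.
- by move=> x _; rewrite lee_fin normal_pdf_ge0.
Qed.

Lemma ge0_integral_normal_prob_mixture m s a t f : s != 0%R -> t != 0%R ->
  measurable_fun setT f -> (forall x, 0 <= f x) ->
  \int[normal_prob m s]_x \int[normal_prob (a * x) t]_z f z =
  \int[normal_prob (a * m) (Num.sqrt ((a * s) ^+ 2 + t ^+ 2))]_z f z.
Proof.
move=> s0 t0 mf f0; pose F p := f p.2 * (normal_pdf (a * p.1) t p.2)%:E.
have mF : measurable_fun setT F.
  apply: emeasurable_funM; first exact: measurableT_comp.
  exact: measurable_normal_pdf_mean.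
have F0 p : 0 <= F p by rewrite mule_ge0// lee_fin normal_pdf_ge0.
transitivity (\int[normal_prob m s]_x \int[mu]_z F (x, z)).
  by apply: eq_integral => x _; exact: ge0_integral_normal_prob.
rewrite [LHS](fubini_tonelli (m1 := normal_prob m s) (m2 := mu) F mF F0).
rewrite [RHS](ge0_integral_normal_prob _ _ mf f0); apply: eq_integral => z _.
rewrite -(integral_normal_pdf_marginal m a z s0 t0) /F/= ge0_integralZl//.
- have mpdf_mean := measurable_normal_pdf_mean a t0.
  exact: measurableT_comp mpdf_mean (measurable_pair2 _).
- by move=> x _; rewrite lee_fin normal_pdf_ge0.
Qed.

Lemma ge0_integral_normal_prob_comb s a b f : (0 < s)%R -> (0 <= a)%R ->
  measurable_fun setT f -> (forall x, 0 <= f x) ->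
  \int[normal_prob 0 s]_x \int[normal_prob 0 s]_y f (a * x + b * y)%R =
  \int[normal_prob 0 s]_x f (Num.sqrt (a ^+ 2 + b ^+ 2) * x)%R.
Proof.
move=> s_gt0 a0 mf f0; have s0 : s != 0%R by rewrite gt_eqF.
have [->|b0] := eqVneq b 0%R.
  rewrite expr0n/= addr0 sqrtr_sqr ger0_norm//; apply: eq_integral => x _.
  under eq_integral do rewrite mul0r addr0.
  exact: integral_normal_prob_cst.
have c_gt0 : (0 < a ^+ 2 + b ^+ 2)%R.
  by rewrite ltr_wpDl ?sqr_ge0// exprn_even_gt0.
have c0 : Num.sqrt (a ^+ 2 + b ^+ 2) != 0%R by rewrite gt_eqF// sqrtr_gt0.
have linE c k : c != 0%R ->
    \int[normal_prob 0 s]_y f (k + c * y)%R = \int[normal_prob k (c * s)]_z f z.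
  move=> c_neq0; have := ge0_integral_normal_prob_affine 0 k s0 c_neq0 mf f0.
  by rewrite mulr0 add0r => <-; apply: eq_integral => y _; rewrite addrC.
transitivity (\int[normal_prob 0 s]_x \int[normal_prob (a * x) (b * s)]_z f z).
  by apply: eq_integral => x _; exact: (linE b (a * x)%R b0).
rewrite [LHS](ge0_integral_normal_prob_mixture 0 a s0 (mulf_neq0 b0 s0) mf f0).
transitivity (\int[normal_prob 0 s]_x f (0 + Num.sqrt (a ^+ 2 + b ^+ 2) * x)%R).
  rewrite [RHS](linE _ _ c0) mulr0; congr (\int[normal_prob 0 _]_x f x).
  by rewrite !exprMn -mulrDl sqrtrM ?ltW// sqrtr_sqr gtr0_norm.
by apply: eq_integral => x _; rewrite add0r.
Qed.

End normal_distribution.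

(** * Isotropic normal vectors *)

Section iid_probability.
Context d (T : measurableType d) (R : realType).
Local Open Scope ereal_scope.

Definition cons_pair m (p : T * m.-tuple T) : m.+1.-tuple T :=
  cons_tuple p.1 p.2.

Lemma measurable_cons_pair m : measurable_fun setT (@cons_pair m).
Proof. exact: (@measurable_cons _ _ _ _ fst m snd). Qed.

HB.instance Definition _ m := isMeasurableFun.Build _ _ _ _
  (@cons_pair m) (@measurable_cons_pair m).

Fixpoint iid_probability (P : probability T R) m : probability (m.-tuple T) R :=
  match m with
  | 0 => \d_[tuple]
  | m'.+1 => distribution (P \x iid_probability P m') (@cons_pair m')
  end.

Lemma integral_iid_nil (P : probability T R) (h : 0.-tuple T -> \bar R) :
  \int[iid_probability P 0]_u h u = h [tuple].
Proof.
rewrite (_ : h = cst (h [tuple])); last by apply/funext => u; rewrite tuple0.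
by rewrite integral_cst//= diracT mule1.
Qed.

Lemma measurable_comp_cons_tuple m (h : m.+1.-tuple T -> \bar R) t :
  measurable_fun setT h -> measurable_fun setT (fun u => h (cons_tuple t u)).
Proof.
move=> mh; apply: measurableT_comp => //.
exact: (@measurable_cons _ _ _ _ (cst t) m id).
Qed.

Lemma ge0_integral_iid_cons (P : probability T R) m
    (h : m.+1.-tuple T -> \bar R) :
  measurable_fun setT h -> (forall u, 0 <= h u) ->
  \int[iid_probability P m.+1]_u h u =
  \int[P]_t \int[iid_probability P m]_u h (cons_tuple t u).
Proof.
move=> mh h0; rewrite ge0_integral_distribution//.
rewrite (fubini_tonelli1 (m1 := P) (m2 := iid_probability P m))//.
- exact: measurableT_comp mh (@measurable_cons_pair m).
- by move=> p; exact: h0.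
Qed.

Lemma measurable_integral_iid_cons (P : probability T R) m
    (h : m.+1.-tuple T -> \bar R) :
  measurable_fun setT h -> (forall u, 0 <= h u) ->
  measurable_fun setT (fun t => \int[iid_probability P m]_u h (cons_tuple t u)).
Proof.
move=> mh h0; have mhcons := measurableT_comp mh (@measurable_cons_pair m).
exact: (measurable_fun_fubini_tonelli_F (m2 := iid_probability P m)
  _ mhcons (fun=> h0 _)).
Qed.

End iid_probability.

Section centered_normal.
Context {R : realType}.

(* [normal_prob] is a measure on [measurableTypeR R]; transporting it along the
   identity gives the same law on [R] with its own measurable structure. *)
Definition borel_id : measurableTypeR R -> R := idfun.

HB.instance Definition _ :=
  @isMeasurableFun.Build _ _ _ _ borel_id (@measurable_id _ _ setT).

Definition centered_normal (s : R) : probability R R :=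
  distribution (normal_prob 0 s) borel_id.

Lemma ge0_integral_centered_normal (s : R) (f : R -> \bar R) :
  measurable_fun setT f -> (forall x, 0 <= f x)%E ->
  (\int[centered_normal s]_x f x = \int[normal_prob 0 s]_x f x)%E.
Proof. by move=> mf f0; rewrite ge0_integral_distribution. Qed.

Lemma ge0_integral_centered_normal_shift (s x : R) (f : R -> \bar R) :
  s != 0 -> measurable_fun setT f -> (forall t, 0 <= f t)%E ->
  (\int[centered_normal s]_t f (x + t)%R =
   \int[centered_normal s]_t ((shift_density1 s x t)%:E * f t))%E.
Proof.
move=> s0 mf f0.
have mwf : measurable_fun setT (fun t => (shift_density1 s x t)%:E * f t)%E.
  by apply: emeasurable_funM => //; exact: measurable_shift_density1.
have wf0 t : (0 <= (shift_density1 s x t)%:E * f t)%E.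
  by rewrite mule_ge0// lee_fin expR_ge0.
have mfD : measurable_fun setT (fun t => f (x + t)).
  by apply: measurableT_comp => //; exact: measurable_funD.
rewrite [LHS](ge0_integral_centered_normal s mfD (fun=> f0 _)).
rewrite [RHS](ge0_integral_centered_normal s mwf wf0).
transitivity (\int[normal_prob (0 + x) s]_t f t)%E; last first.
  rewrite [LHS](ge0_integral_normal_prob_shift 0 x s0 mf f0).
  by apply: eq_integral => t _; rewrite subr0.
have -> : normal_prob (0 + x) s = normal_prob (1 * 0 + x) (1 * s).
  by rewrite mulr0 mul1r.
rewrite -[RHS](ge0_integral_normal_prob_affine 0 x s0 (oner_neq0 R) mf f0).
by apply: eq_integral => t _; rewrite mul1r addrC.
Qed.

Lemma ge0_integral_centered_normal_comb (s a b : R) (f : R -> \bar R) :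
  0 < s -> 0 <= a -> measurable_fun setT f -> (forall x, 0 <= f x)%E ->
  (\int[centered_normal s]_x \int[centered_normal s]_y f (a * x + b * y)%R =
   \int[centered_normal s]_x f (Num.sqrt (a ^+ 2 + b ^+ 2) * x)%R)%E.
Proof.
move=> s_gt0 a0 mf f0.
have mF : measurable_fun setT (fun p : R * R => f (a * p.1 + b * p.2)).
  apply: measurableT_comp => //.
  by apply: measurable_funD; exact: measurable_funM.
have mFy x : measurable_fun setT (fun y => f (a * x + b * y)).
  exact: measurableT_comp mF (measurable_pair1 x).
have mFx := measurable_fun_fubini_tonelli_F (m2 := centered_normal s)
  _ mF (fun=> f0 _).
have mfM (c : R) : measurable_fun setT (fun x => f (c * x)).
  by apply: measurableT_comp => //; exact: measurable_funM.
rewrite [LHS](ge0_integral_centered_normal s mFx); last first.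
  by move=> x; exact: integral_ge0.
rewrite [RHS](ge0_integral_centered_normal s (mfM _) (fun=> f0 _)).
rewrite -[RHS](ge0_integral_normal_prob_comb b s_gt0 a0 mf f0).
apply: eq_integral => x _.
exact: (ge0_integral_centered_normal s (mFy x) (fun=> f0 _)).
Qed.

End centered_normal.

Section normal_vector.
Context {R : realType}.
Implicit Types (s x y : R).

Definition dot m (d e : m.-tuple R) : R := \sum_(i < m) tnth d i * tnth e i.

Lemma dot_cons m x y (d e : m.-tuple R) :
  dot (cons_tuple x d) (cons_tuple y e) = x * y + dot d e.
Proof.
rewrite /dot big_ord_recl !tnth0; congr (_ + _).
by apply: eq_bigr => i _; rewrite !tnthS.
Qed.

Lemma dotDr m (d e e' : m.-tuple R) : dot d (vadd e e') = dot d e + dot d e'.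
Proof.
rewrite /dot -big_split; apply: eq_bigr => i _.
by rewrite tnth_mktuple mulrDr.
Qed.

Lemma norm2_ge0 m (d : m.-tuple R) : 0 <= norm2 d.
Proof. exact: sqrtr_ge0. Qed.

Lemma norm2_sqr m (d : m.-tuple R) : norm2 d ^+ 2 = dot d d.
Proof.
rewrite sqr_sqrtr; last by apply: sumr_ge0 => i _; exact: sqr_ge0.
by apply: eq_bigr => i _; rewrite expr2.
Qed.

Lemma norm2_cons m x (d : m.-tuple R) :
  norm2 (cons_tuple x d) = Num.sqrt (norm2 d ^+ 2 + x ^+ 2).
Proof.
rewrite norm2_sqr addrC expr2 -dot_cons -norm2_sqr sqrtr_sqr.
by rewrite ger0_norm ?norm2_ge0.
Qed.

Lemma vadd_cons m x y (d e : m.-tuple R) :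
  vadd (cons_tuple x d) (cons_tuple y e) = cons_tuple (x + y) (vadd d e).
Proof.
apply: eq_from_tnth => i; rewrite tnth_mktuple.
have [j ->|->] := unliftP ord0 i; last by rewrite !tnth0.
by rewrite !tnthS tnth_mktuple.
Qed.

Lemma vaddA m (d e e' : m.-tuple R) : vadd (vadd d e) e' = vadd d (vadd e e').
Proof. by apply: eq_from_tnth => i; rewrite !tnth_mktuple addrA. Qed.

Definition vopp m (d : m.-tuple R) : m.-tuple R := [tuple - tnth d i | i < m].

Lemma norm2_vopp m (d : m.-tuple R) : norm2 (vopp d) = norm2 d.
Proof.
by congr Num.sqrt; apply: eq_bigr => i _; rewrite tnth_mktuple sqrrN.
Qed.

Lemma vaddNKr m (d e : m.-tuple R) : vadd d (vadd (vopp d) e) = e.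
Proof. by apply: eq_from_tnth => i; rewrite !tnth_mktuple addNKr. Qed.

Lemma norm2_eq0_vadd m (d e : m.-tuple R) : norm2 d = 0 -> vadd d e = e.
Proof.
move=> d0; apply: eq_from_tnth => i; rewrite tnth_mktuple.
have /esym/eqP := norm2_sqr d.
rewrite d0 expr0n psumr_eq0 => [|j _]; last by rewrite -expr2 sqr_ge0.
move=> /allP/(_ i (mem_index_enum i)); rewrite mulf_eq0 orbb => /eqP->.
by rewrite add0r.
Qed.

Lemma measurable_dot m (d : m.-tuple R) : measurable_fun setT (dot d).
Proof.
apply: measurable_sum => i; apply: measurable_funM => //.
exact: measurable_tnth.
Qed.

Lemma measurable_vadd m (d : m.-tuple R) : measurable_fun setT (vadd d).
Proof.
apply/measurable_fun_tnthP => i.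
rewrite (_ : _ \o _ = fun e => tnth d i + tnth e i).
  by apply: measurable_funD => //; exact: measurable_tnth.
by apply/funext => e /=; rewrite tnth_mktuple.
Qed.

Definition normal_vector s m : probability (m.-tuple R) R :=
  iid_probability (centered_normal s) m.

Lemma gauss_expE s m (h : m.-tuple R -> \bar R) :
  measurable_fun setT h -> (forall u, 0 <= h u)%E ->
  gauss_exp s h = (\int[normal_vector s m]_u h u)%E.
Proof.
elim: m h => [|m IHm] h mh h0; first by rewrite [RHS]integral_iid_nil.
rewrite [RHS]ge0_integral_iid_cons// ge0_integral_centered_normal.
- apply: eq_integral => t _.
  by apply: IHm => //; exact: measurable_comp_cons_tuple.
- exact: measurable_integral_iid_cons.
- by move=> t; exact: integral_ge0.
Qed.

Definition shift_density s m (d e : m.-tuple R) : R :=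
  expR (dot d e / s ^+ 2 - norm2 d ^+ 2 / (2 * s ^+ 2)).

Lemma measurable_shift_density s m (d : m.-tuple R) :
  measurable_fun setT (shift_density s d).
Proof.
apply: measurableT_comp => //; apply: measurable_funB => //.
by apply: measurable_funM => //; exact: measurable_dot.
Qed.

Lemma shift_density_cons s m x y (d e : m.-tuple R) : s != 0 ->
  shift_density s (cons_tuple x d) (cons_tuple y e) =
  shift_density1 s x y * shift_density s d e.
Proof.
move=> s0; rewrite /shift_density /shift_density1 -expRD !norm2_sqr !dot_cons.
by congr expR; field.
Qed.

Lemma shift_density_nil s (d e : 0.-tuple R) : shift_density s d e = 1.
Proof.
rewrite /shift_density /dot /norm2 !big_ord0 sqrtr0 expr0n/= !mul0r subrr.
exact: expR0.
Qed.

Local Open Scope ereal_scope.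

Lemma measurable_shift_density_mul s m (d : m.-tuple R)
    (h : m.-tuple R -> \bar R) :
  measurable_fun setT h ->
  measurable_fun setT (fun e => (shift_density s d e)%:E * h e).
Proof.
move=> mh; apply: emeasurable_funM => //; apply/measurable_EFinP.
exact: measurable_shift_density.
Qed.

Lemma shift_density_mul_ge0 s m (d e : m.-tuple R) (h : m.-tuple R -> \bar R) :
  (forall u, 0 <= h u) -> 0 <= (shift_density s d e)%:E * h e.
Proof. by move=> h0; rewrite mule_ge0// lee_fin expR_ge0. Qed.

Lemma ge0_integral_normal_vector_vadd s m (d : m.-tuple R)
    (h : m.-tuple R -> \bar R) :
  s != 0%R -> measurable_fun setT h -> (forall u, 0 <= h u) ->
  \int[normal_vector s m]_e h (vadd d e) =
  \int[normal_vector s m]_e ((shift_density s d e)%:E * h e).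
Proof.
move=> s0; elim: m d h => [|m IHm] d h mh h0.
  by rewrite !integral_iid_nil shift_density_nil mul1e (tuple0 (vadd _ _)).
case/tupleP: d => x d.
pose F (p : R * m.-tuple R) := (shift_density s d p.2)%:E * h (cons_pair p).
have mF : measurable_fun setT F.
  apply: emeasurable_funM.
    apply/measurable_EFinP; apply: measurableT_comp => //.
    exact: measurable_shift_density.
  exact: measurableT_comp mh (@measurable_cons_pair _ _ m).
have F0 p : 0 <= F p by rewrite mule_ge0// lee_fin expR_ge0.
pose W t := \int[normal_vector s m]_u F (t, u).
have mW : measurable_fun setT W.
  exact: (measurable_fun_fubini_tonelli_F (m2 := normal_vector s m) _ mF F0).
have W0 t : 0 <= W t by exact: integral_ge0.
have mh_vadd := measurableT_comp mh (measurable_vadd (cons_tuple x d)).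
rewrite [LHS](ge0_integral_iid_cons _ mh_vadd (fun=> h0 _)).
rewrite [RHS](ge0_integral_iid_cons _ (measurable_shift_density_mul _ _ mh)
  (fun=> shift_density_mul_ge0 _ _ _ h0)).
transitivity (\int[centered_normal s]_t W (x + t)%R).
  apply: eq_integral => t _.
  rewrite -[RHS](IHm d (fun u => h (cons_tuple (x + t)%R u)))//.
    by apply: eq_integral => u _; rewrite -vadd_cons.
  exact: measurable_comp_cons_tuple.
rewrite [LHS](ge0_integral_centered_normal_shift x s0 mW W0).
apply: eq_integral => t _; rewrite -ge0_integralZl//.
- by apply: eq_integral => u _; rewrite shift_density_cons// EFinM muleA.
- exact: measurableT_comp mF (measurable_pair1 t).
- by rewrite lee_fin expR_ge0.
Qed.

Lemma ge0_integral_normal_vector_dot s m (d : m.-tuple R) (phi : R -> \bar R) :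
  (0 < s)%R -> measurable_fun setT phi -> (forall t, 0 <= phi t) ->
  \int[normal_vector s m]_e phi (dot d e) =
  \int[centered_normal s]_t phi (norm2 d * t)%R.
Proof.
move=> s_gt0; elim: m d phi => [|m IHm] d phi mphi phi0.
  rewrite integral_iid_nil /dot /norm2 !big_ord0 sqrtr0.
  under eq_integral do rewrite mul0r.
  by rewrite integral_cst// [X in _ * X]probability_setT mule1.
case/tupleP: d => x d; pose F p := phi (norm2 d * p.1 + x * p.2)%R.
have mF : measurable_fun setT F.
  apply: measurableT_comp => //.
  by apply: measurable_funD; exact: measurable_funM.
have comb := ge0_integral_centered_normal_comb x s_gt0 (norm2_ge0 d) mphi phi0.
rewrite norm2_cons -comb.
rewrite [RHS](fubini_tonelli (m1 := centered_normal s) (m2 := centered_normal s)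
  F mF (fun=> phi0 _)).
have mphi_dot := measurableT_comp mphi (measurable_dot (cons_tuple x d)).
rewrite [LHS](ge0_integral_iid_cons _ mphi_dot (fun=> phi0 _)).
apply: eq_integral => t _; rewrite -[RHS](IHm d (fun y => phi (y + x * t)%R))//.
- by apply: eq_integral => u _; rewrite /= dot_cons addrC.
- by apply: measurableT_comp => //; exact: measurable_funD.
Qed.

Lemma normal_vector_dot s m (d : m.-tuple R) (A : set R) :
  (0 < s)%R -> measurable A ->
  normal_vector s m (dot d @^-1` A) =
  centered_normal s ((fun t => norm2 d * t)%R @^-1` A).
Proof.
move=> s_gt0 mA; pose phi t : \bar R := (\1_A t)%:E.
have mphi : measurable_fun setT phi.
  by apply/measurable_EFinP; exact: measurable_indic.
have phi0 t : 0 <= phi t by rewrite lee_fin.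
have mdotA : measurable (dot d @^-1` A).
  by rewrite -[_ @^-1` _]setTI; exact: measurable_dot.
have mscaleA : measurable ((fun t => norm2 d * t)%R @^-1` A).
  by rewrite -[_ @^-1` _]setTI; apply: measurable_funM mA.
rewrite [LHS](measure_integral_indic (normal_vector s m) mdotA).
rewrite [RHS](measure_integral_indic (centered_normal s) mscaleA).
exact: (ge0_integral_normal_vector_dot d s_gt0 mphi phi0).
Qed.

End normal_vector.

(** * The normal distribution function and its quantiles *)

Section normal_cdf.
Context {R : realType}.
Implicit Types (p x y : R) (q : \bar R).

Lemma PhiEFin x : (Phi x)%:E = cdf (borel_id : {RV normal_prob 0 1 >-> R}) x.
Proof. by rewrite fineK// fin_num_measure. Qed.

Lemma Phi_ge0 x : 0 <= Phi x.
Proof. by rewrite -lee_fin PhiEFin cdf_ge0. Qed.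

Lemma Phi_le1 x : Phi x <= 1.
Proof. by rewrite -lee_fin PhiEFin cdf_le1. Qed.

Lemma cvg_Phi_y1 : Phi x @[x --> +oo] --> (1 : R).
Proof.
exact: fine_cvg (cvg_cdfy1 (borel_id : {RV normal_prob 0 1 >-> R})).
Qed.

Lemma cvg_Phi_Ny0 : Phi x @[x --> -oo] --> (0 : R).
Proof.
exact: fine_cvg (cvg_cdfNy0 (borel_id : {RV normal_prob 0 1 >-> R})).
Qed.

Lemma derive1_Phi x :
  derivable (@Phi R) x 1 /\ derive1 (@Phi R) x = normal_pdf 0 1 x.
Proof.
apply: (@continuous_FTC1 R (normal_pdf 0 1) -oo%O x (x + 1)).
- by rewrite ltrDl.
- exact: integrableS (integrable_normal_pdf 0 1).
- exact: ltNyr.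
- exact: continuous_normal_pdf.
Qed.

Lemma continuous_Phi : continuous (@Phi R).
Proof.
move=> x; apply/differentiable_continuous/derivable1_diffP.
by have [] := derive1_Phi x.
Qed.

Lemma Phi_le : {mono (@Phi R) : x y / x <= y}.
Proof.
apply: le_mono => x y xy; apply: (@gtr0_derive1_lt_cc _ _ x y) => //.
- by move=> z _; have [] := derive1_Phi z.
- move=> z _; have [_ ->] := derive1_Phi z.
  by rewrite normal_pdfE// mulr_gt0 ?normal_peak_gt0// expR_gt0.
- exact/continuous_subspaceT/continuous_Phi.
- by rewrite in_itv/= lexx ltW.
- by rewrite in_itv/= lexx ltW.
Qed.

Lemma Phi_lt : {mono (@Phi R) : x y / x < y}.
Proof. exact: leW_mono Phi_le. Qed.

Lemma Phi_gt0 x : 0 < Phi x.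
Proof.
by apply: le_lt_trans (Phi_ge0 (x - 1)) _; rewrite Phi_lt ltrBlDr ltrDl.
Qed.

Lemma Phi_lt1 x : Phi x < 1.
Proof. by apply: lt_le_trans (Phi_le1 (x + 1)); rewrite Phi_lt ltrDl. Qed.

Lemma PhiE_le : {mono (@PhiE R) : q q' / (q <= q')%E >-> q <= q'}.
Proof.
move=> [x| |] [y| |];
  rewrite /= ?lexx ?ler01 ?ler10 ?leey ?leNye ?Phi_le1 ?Phi_ge0//.
- by rewrite Phi_le lee_fin.
- by rewrite leNgt Phi_gt0 leeNy_eq.
- by rewrite leNgt Phi_lt1 leye_eq.
Qed.

Lemma Phi_surj p : 0 < p < 1 -> exists x, Phi x = p.
Proof.
move=> /andP[p0 p1].
have [y py] := filter_ex (cvgr_gt 1 cvg_Phi_y1 p p1).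
have [x xp] := filter_ex (cvgr_lt 0 cvg_Phi_Ny0 p p0).
have xy : x <= y by rewrite ltW// -Phi_lt (lt_trans xp).
have p_mid : Num.min (Phi x) (Phi y) <= p <= Num.max (Phi x) (Phi y).
  by rewrite ge_min (ltW xp) le_max (ltW py) orbT.
have [z _ <-] := IVT xy (continuous_subspaceT continuous_Phi) p_mid.
by exists z.
Qed.

Lemma PhiK x : PhiInv (Phi x) = x%:E.
Proof.
rewrite /PhiInv leNgt Phi_gt0 leNgt Phi_lt1/=; congr EFin.
rewrite (_ : [set y | _] = `[x, +oo[%classic) ?inf_itv//.
by apply/seteqP; split => y /=; rewrite in_itv/= andbT !leNgt Phi_lt.
Qed.

Lemma PhiE_PhiInv p : PhiE (PhiInv p) = Num.max 0 (Num.min 1 p).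
Proof.
have [p0|p0] := leP p 0.
  by rewrite /PhiInv p0 min_r ?max_l// (le_trans p0).
have [p1|p1] := leP 1 p.
  by rewrite /PhiInv leNgt p0 p1 max_r.
have [|x Phix] := @Phi_surj p; first by rewrite p0.
by rewrite -Phix PhiK max_r// Phi_ge0.
Qed.

End normal_cdf.

(** * The Neyman-Pearson bounds *)

Section neyman_pearson.
Context d (T : measurableType d) (R : realType).
Implicit Types (h : T -> R) (A : set T).

Definition randomized_test h :=
  measurable_fun setT h /\ forall x, 0 <= h x <= 1.

Lemma randomized_test_indic A : measurable A -> randomized_test (\1_A).
Proof.
move=> mA; split=> [|x]; first exact: measurable_indic.
by rewrite indicE ler0n lern1 leq_b1.
Qed.

Lemma integrable_mul_randomized_test (mu : {measure set T -> \bar R})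
    (w : T -> R) h :
  mu.-integrable setT (EFin \o w) -> randomized_test h ->
  mu.-integrable setT (EFin \o (fun x => w x * h x)).
Proof.
move=> iw [mh h01].
have mw : measurable_fun setT w.
  exact/measurable_EFinP/(measurable_int mu iw).
apply: le_integrable iw => //; first exact/measurable_EFinP/measurable_funM.
move=> x _; have /andP[h0 h1] := h01 x.
by rewrite /= lee_fin normrM (ger0_norm h0) ler_piMr.
Qed.

Lemma integrable_randomized_test (P : probability T R) h :
  randomized_test h -> P.-integrable setT (EFin \o h).
Proof.
move=> th; have int1 := finite_measure_integrable_cst P 1 measurableT.
have := integrable_mul_randomized_test int1 th.
by apply: eq_integrable => // x _; rewrite /= mul1r.
Qed.

Lemma randomized_test_mean_itv (P : probability T R) h :
  randomized_test h -> 0 <= \int[P]_x h x <= 1.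
Proof.
move=> th; have [mh h01] := th.
rewrite Rintegral_ge0 => [|x _]; last by case/andP: (h01 x).
have -> : (1 : R) = \int[P]_x 1.
  by rewrite Rintegral_cst// [X in fine X]probability_setT mulr1.
apply: le_Rintegral => //; first exact: integrable_randomized_test.
  exact: finite_measure_integrable_cst.
by move=> x _; case/andP: (h01 x).
Qed.

Lemma neyman_pearson (mu : {measure set T -> \bar R}) (w g h : T -> R) (l : R) :
  mu.-integrable setT (EFin \o g) -> mu.-integrable setT (EFin \o h) ->
  mu.-integrable setT (EFin \o (fun x => w x * g x)) ->
  mu.-integrable setT (EFin \o (fun x => w x * h x)) ->
  0 <= l -> (forall x, 0 <= (g x - h x) * (w x - l)) ->
  \int[mu]_x h x <= \int[mu]_x g x ->
  \int[mu]_x (w x * h x) <= \int[mu]_x (w x * g x).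
Proof.
move=> ig ih iwg iwh l0 gh_sep hg; rewrite -subr_ge0 -RintegralB//.
have integrable_sub u v : mu.-integrable setT (EFin \o u) ->
    mu.-integrable setT (EFin \o v) ->
    mu.-integrable setT (EFin \o (fun x => u x - v x)).
  by move=> iu iv; apply: eq_integrable (integrableB measurableT iu iv).
apply: (@le_trans _ _ (\int[mu]_x (l * (g x - h x)))).
  rewrite RintegralZl//; last exact: integrable_sub.
  by rewrite RintegralB// mulr_ge0// subr_ge0.
apply: le_Rintegral => //.
- have igh := integrable_sub _ _ ig ih.
  by apply: eq_integrable (integrableZl measurableT l igh).
- exact: integrable_sub.
- by move=> x _; rewrite -subr_ge0; apply: le_trans (gh_sep x) _; lra.
Qed.

End neyman_pearson.

Section normal_shift.
Context {R : realType} (s : R) (m : nat).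
Hypothesis s_gt0 : 0 < s.
Local Notation nv := (normal_vector s m).
Implicit Types (d e : m.-tuple R) (h : m.-tuple R -> R) (q : R).

Let s0 : s != 0. Proof. by rewrite gt_eqF. Qed.

Lemma randomized_test_vadd d h :
  randomized_test h -> randomized_test (fun e => h (vadd d e)).
Proof.
move=> [mh h01]; split=> //.
exact: measurableT_comp mh (measurable_vadd d).
Qed.

Lemma integrable_shift_density d :
  nv.-integrable setT (EFin \o shift_density s d).
Proof.
apply/integrableP; split.
  by apply/measurable_EFinP; exact: measurable_shift_density.
under eq_integral do rewrite /= ger0_norm ?expR_ge0// -[_%:E]mule1.
rewrite -(ge0_integral_normal_vector_vadd d s0 (measurable_cst 1%E))//=.
by rewrite integral_cst// [X in (_ * X)%E]probability_setT mule1 ltry.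
Qed.

Lemma Rintegral_normal_vector_vadd d h : randomized_test h ->
  \int[nv]_e h (vadd d e) = \int[nv]_e (shift_density s d e * h e).
Proof.
move=> [mh h01]; congr fine.
have mEh : measurable_fun setT (EFin \o h) by apply/measurable_EFinP.
rewrite [LHS](ge0_integral_normal_vector_vadd d s0 mEh)//.
by move=> e; rewrite lee_fin; case/andP: (h01 e).
Qed.

Definition halfspace d (c : R) : set (m.-tuple R) := dot d @^-1` `]-oo, c].

Lemma measurable_halfspace d c : measurable (halfspace d c).
Proof. by rewrite -[X in measurable X]setTI; exact: measurable_dot. Qed.

Lemma indic_halfspace d c e : \1_(halfspace d c) e = (dot d e <= c)%R%:R :> R.
Proof.
by rewrite [LHS](indic_bool (fun e => dot d e \in `]-oo, c])) in_itv.
Qed.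

Lemma normal_vector_halfspace d q : norm2 d != 0 ->
  nv (halfspace d (norm2 d * (s * q))) = (Phi q)%:E.
Proof.
move=> d0; have d_gt0 : 0 < norm2 d by rewrite lt0r d0 norm2_ge0.
rewrite [LHS]normal_vector_dot//.
have -> : (fun t => norm2 d * t) @^-1` `]-oo, norm2 d * (s * q)] =
    `]-oo, s * q]%classic.
  by apply/seteqP; split=> t; rewrite /= !in_itv/= ler_pM2l.
rewrite PhiEFin -[LHS]/(normal_prob 0 s `]-oo, s * q]%classic).
transitivity (normal_prob (s * 0 + 0) (s * 1) `]-oo, s * q]%classic).
  by rewrite mulr0 addr0 mulr1.
rewrite -[LHS]normal_prob_affine//; congr (normal_prob 0 1).
by apply/seteqP; split=> t; rewrite /= !in_itv/= addr0 ler_pM2l.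
Qed.

Lemma Rintegral_halfspace d q : norm2 d != 0 ->
  \int[nv]_e \1_(halfspace d (norm2 d * (s * q))) e = Phi q.
Proof.
move=> d0; rewrite -[RHS]/(fine (Phi q)%:E) -(normal_vector_halfspace q d0).
by rewrite [in RHS](measure_integral_indic nv (measurable_halfspace _ _)).
Qed.

Lemma Rintegral_halfspace_vadd d q : norm2 d != 0 ->
  \int[nv]_e \1_(halfspace d (norm2 d * (s * q))) (vadd d e) =
  Phi (q - norm2 d / s).
Proof.
move=> d0; rewrite -(Rintegral_halfspace _ d0); apply: eq_Rintegral => e _.
rewrite !indic_halfspace dotDr -norm2_sqr -lerBrDl.
by congr ((_ <= _)%R%:R); field.
Qed.

Lemma shift_density_le d e q :
  (shift_density s d e <=
     expR (norm2 d * q / s - norm2 d ^+ 2 / (2 * s ^+ 2))) =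
  (dot d e <= norm2 d * (s * q)).
Proof.
have -> : norm2 d * q / s = norm2 d * (s * q) / s ^+ 2 by field.
by rewrite ler_expR lerD2r ler_pM2r// invr_gt0 exprn_gt0.
Qed.

(* Half-spaces orthogonal to [d] are most powerful because the likelihood ratio
   of the translation by [d] increases with [dot d]. *)
Lemma normal_mean_vadd_ge_Phi d h q : randomized_test h ->
  Phi q <= \int[nv]_e h e ->
  Phi (q - norm2 d / s) <= \int[nv]_e h (vadd d e).
Proof.
move=> th qh; have [d0|d0] := eqVneq (norm2 d) 0.
  by under eq_Rintegral do rewrite norm2_eq0_vadd//; rewrite d0 mul0r subr0.
pose g : m.-tuple R -> R := \1_(halfspace d (norm2 d * (s * q))).
have tg : randomized_test g.
  by apply: randomized_test_indic; exact: measurable_halfspace.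
rewrite -(Rintegral_halfspace_vadd q d0) !Rintegral_normal_vector_vadd//.
have iw := integrable_shift_density d.
apply: (@neyman_pearson _ _ _ _ _ _ _
  (expR (norm2 d * q / s - norm2 d ^+ 2 / (2 * s ^+ 2)))).
- exact: integrable_randomized_test.
- exact: integrable_randomized_test.
- exact: integrable_mul_randomized_test.
- exact: integrable_mul_randomized_test.
- exact: expR_ge0.
- move=> e; have /andP[h0 h1] := th.2 e.
  rewrite /g indic_halfspace -shift_density_le.
  case: (leP (shift_density s d e)) => [le_l|/ltW l_le].
    by apply: mulr_le0; rewrite subr_le0.
  by apply: mulr_ge0; rewrite subr_ge0.
- by rewrite Rintegral_halfspace.
Qed.

Lemma normal_mean_vadd_ge d h (q : \bar R) : randomized_test h ->
  PhiE q <= \int[nv]_e h e ->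
  PhiE (q - (norm2 d / s)%:E) <= \int[nv]_e h (vadd d e).
Proof.
move=> th; have thd := randomized_test_vadd d th.
have /andP[hd0 hd1] := randomized_test_mean_itv nv thd.
case: q => [q| |] //= qh; first exact: normal_mean_vadd_ge_Phi.
apply: (cvgr_to_le cvg_Phi_y1); apply: nearW => q.
rewrite -(addrK (norm2 d / s) q); apply: normal_mean_vadd_ge_Phi => //.
exact: le_trans (Phi_le1 _) qh.
Qed.

(* Translating back by [-d] turns the lower bound into an upper bound. *)
Lemma normal_mean_vadd_le d h (q : \bar R) : randomized_test h ->
  \int[nv]_e h e <= PhiE q ->
  \int[nv]_e h (vadd d e) <= PhiE (q + (norm2 d / s)%:E).
Proof.
move=> th hq; have thd := randomized_test_vadd d th.
have /andP[hd0 hd1] := randomized_test_mean_itv nv thd.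
set hd := fun e => h (vadd d e); set p := \int[nv]_e hd e.
have PhiInvp : PhiE (PhiInv p) = p by rewrite PhiE_PhiInv min_r// max_r.
rewrite -PhiInvp PhiE_le -leeBlDr// -PhiE_le; apply: le_trans hq.
have := @normal_mean_vadd_ge (vopp d) hd (PhiInv p) thd.
rewrite PhiInvp lexx norm2_vopp => /(_ isT) /le_trans; apply.
by under eq_Rintegral do rewrite /hd vaddNKr.
Qed.

End normal_shift.

(** * Order statistics of sublists *)

Section order_statistics.

Lemma sorted_nth_subseq (T : eqType) (r : rel T) (x0 : T) (s t : seq T) l :
  transitive r -> reflexive r -> sorted r t -> subseq s t -> (l < size s)%N ->
  r (nth x0 t l) (nth x0 s l).
Proof.
move=> tr rr; elim: t s l => [|y t IHt] [|x s] l // rt.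
have rt' : sorted r t := path_sorted rt.
rewrite [subseq _ _]/=; case: eqP => [->|_] st.
  by case: l => [|l] ls; [exact: rr|exact: IHt].
move=> ls; apply: (tr _ _ _ _ (IHt (x :: s) l rt' st ls)).
have lt : (l < size t)%N := leq_trans ls (size_subseq st).
by apply: (sorted_leq_nth tr rr x0 rt l l.+1); rewrite ?inE //= ltnW.
Qed.

Lemma sorted_subseq_nth (T : eqType) (r : rel T) (x0 : T) (s t : seq T) l j :
  transitive r -> reflexive r -> sorted r t -> subseq s t -> (l < size s)%N ->
  (l + (size t - size s) <= j < size t)%N -> r (nth x0 s l) (nth x0 t j).
Proof.
move=> tr rr rt st ls /andP[lj jt]; have sst := size_subseq st.
have := @sorted_nth_subseq T (fun x y => r y x) x0 (rev s) (rev t)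
  (size s - l.+1).
rewrite !nth_rev ?size_rev; [|lia..].
have -> : (size s - (size s - l.+1).+1 = l)%N by lia.
have -> : (size t - (size s - l.+1).+1 = l + (size t - size s))%N by lia.
rewrite rev_sorted subseq_rev => rev_rel.
have r_align : r (nth x0 s l) (nth x0 t (l + (size t - size s))).
  by apply: rev_rel => //; [exact: rev_trans|lia].
apply: (tr _ _ _ r_align).
by apply: (sorted_leq_nth tr rr x0 rt) => //; rewrite inE; lia.
Qed.

Context {R : realType} (I : eqType).
Implicit Types (v : I -> R) (s t : seq I).

Lemma ler_sum_in s v v' :
  {in s, forall i, v i <= v' i} -> \sum_(i <- s) v i <= \sum_(i <- s) v' i.
Proof. by move=> vv'; rewrite big_seq [leRHS]big_seq; exact: ler_sum. Qed.

Lemma sum_take_drop v s i n : (i + n <= size s)%N ->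
  \sum_(x <- take n (drop i s)) v x = \sum_(i <= l < i + n) nth 0 (map v s) l.
Proof.
move=> ins; rewrite -(big_map v xpredT id) (big_nth 0) size_map.
rewrite size_takel; last by rewrite size_drop; lia.
rewrite -{2}[i]add0n big_addn addKn [in LHS]big_nat [in RHS]big_nat.
apply: eq_bigr => j /= jn.
by rewrite map_take map_drop nth_take// nth_drop addnC.
Qed.

Lemma sum_window_subseq_le v s t i n :
  sorted (fun x y => v y <= v x) t -> subseq s t -> (i + n <= size s)%N ->
  \sum_(x <- take n (drop i s)) v x <= \sum_(i <= l < i + n) nth 0 (map v t) l.
Proof.
move=> vt st ins; rewrite sum_take_drop//; apply: ler_sum_nat => l /andP[_ lin].
apply: (@sorted_nth_subseq R (fun x y => y <= x)) => //.
- exact: rev_trans le_trans.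
- by rewrite sorted_map.
- exact: map_subseq.
- by rewrite size_map (leq_trans lin).
Qed.

Lemma sum_take_subseq_ge v s t i n :
  sorted (fun x y => v y <= v x) t -> subseq s t -> (n <= size s)%N ->
  (size t - size s <= i)%N -> (i + n <= size t)%N ->
  \sum_(i <= l < i + n) nth 0 (map v t) l <= \sum_(x <- take n s) v x.
Proof.
move=> vt st ns tsi itn; rewrite -[s in take n s]drop0 sum_take_drop//.
rewrite -{1}[i]add0n big_addn addKn add0n; apply: ler_sum_nat => l /andP[_ ln].
apply: (@sorted_subseq_nth R (fun x y => y <= x)) => //.
- exact: rev_trans le_trans.
- by rewrite sorted_map.
- exact: map_subseq.
- by rewrite size_map (leq_trans ln).
- by rewrite !size_map; lia.
Qed.

End order_statistics.

Lemma count_mem_uniq (T : finType) (A : {set T}) (s : seq T) : uniq s ->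
  (count (mem A) s <= minn (size s) #|A|)%N.
Proof.
move=> us; rewrite leq_min count_size -size_filter cardE; apply: uniq_leq_size.
  exact: filter_uniq.
by move=> i; rewrite mem_filter mem_enum => /andP[].
Qed.

(** * Label probabilities and the certificate *)

Lemma integrable_sum_EFin d (T : measurableType d) (R : realType)
    (mu : {measure set T -> \bar R}) (I : Type) (t : seq I) (h : I -> T -> R) :
  (forall i, mu.-integrable setT (EFin \o h i)) ->
  mu.-integrable setT (EFin \o (fun x => \sum_(i <- t) h i x)).
Proof.
move=> int_h.
have := integrable_sum measurableT t (P := xpredT) (fun i _ => int_h i).
by apply: eq_integrable => // x _; rewrite /= sumEFin.
Qed.

Lemma Rintegral_sum d (T : measurableType d) (R : realType)
    (mu : {measure set T -> \bar R}) (I : Type) (t : seq I) (h : I -> T -> R) :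
  (forall i, mu.-integrable setT (EFin \o h i)) ->
  \int[mu]_x (\sum_(i <- t) h i x) = \sum_(i <- t) \int[mu]_x h i x.
Proof.
move=> int_h; elim: t => [|i t IHt].
  under eq_Rintegral do rewrite big_nil.
  by rewrite big_nil Rintegral_cst// mul0r.
under eq_Rintegral do rewrite big_cons.
by rewrite big_cons RintegralD// ?IHt//; exact: integrable_sum_EFin.
Qed.

Section label_probabilities.
Context {R : realType} (s : R) (m c : nat) (f : m.-tuple R -> {set 'I_c}).
Hypothesis s_gt0 : 0 < s.
Hypothesis mf : forall i, measurable [set w : m.-tuple R | i \in f w].
Local Notation nv := (normal_vector s m).
Implicit Types (x d : m.-tuple R) (t : seq 'I_c) (N : nat) (p r tau : R).

Let randomized_test_label i : randomized_test (fun w => (i \in f w)%:R : R).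
Proof.
rewrite (_ : (fun w => _) = \1_[set w | i \in f w]).
  exact: randomized_test_indic.
by apply/funext => w; rewrite indic_bool.
Qed.

Lemma label_probE x i : label_prob s f x i = \int[nv]_e (i \in f (vadd x e))%:R.
Proof.
have [mi _] := randomized_test_vadd x (randomized_test_label i).
by congr fine; rewrite gauss_expE//; exact/measurable_EFinP.
Qed.

Lemma label_prob_ge0 x i : 0 <= label_prob s f x i.
Proof. by rewrite label_probE Rintegral_ge0. Qed.

Definition label_frequency t N w : R :=
  (\sum_(i <- t) (i \in f w)%:R) / N%:R.

Lemma randomized_test_label_frequency t N : (0 < N)%N ->
  (forall w, count (mem (f w)) t <= N)%N ->
  randomized_test (label_frequency t N).
Proof.
move=> N0 tN; split=> [|w].
  apply: measurable_funM => //; apply: measurable_sum => i.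
  by have [] := randomized_test_label i.
have -> : label_frequency t N w = (count (mem (f w)) t)%:R / N%:R.
  by rewrite /label_frequency -natr_sum -sumn_count sumnE big_map.
by rewrite divr_ge0//= ler_pdivrMr ?ltr0n// mul1r ler_nat.
Qed.

Lemma mean_label_frequency t N x :
  \int[nv]_e label_frequency t N (vadd x e) =
  (\sum_(i <- t) label_prob s f x i) / N%:R.
Proof.
have int_i i :
    nv.-integrable setT (EFin \o (fun e => (i \in f (vadd x e))%:R : R)).
  have test_i := randomized_test_vadd x (randomized_test_label i).
  exact: integrable_randomized_test test_i.
rewrite RintegralZr//; last exact: integrable_sum_EFin.
rewrite Rintegral_sum//; congr (_ / _); apply: eq_bigr => i _.
by rewrite label_probE.
Qed.

Lemma sum_label_prob_shift_ge t N x d p r : (0 < N)%N ->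
  (forall w, count (mem (f w)) t <= N)%N -> norm2 d / s <= r ->
  p <= \sum_(i <- t) label_prob s f x i ->
  N%:R * PhiE (PhiInv (p / N%:R) - r%:E) <=
  \sum_(i <- t) label_prob s f (vadd x d) i.
Proof.
move=> N0 tN dr p_le.
have tF := randomized_test_vadd x (randomized_test_label_frequency N0 tN).
rewrite mulrC -ler_pdivlMr ?ltr0n// -mean_label_frequency.
under eq_Rintegral do rewrite vaddA.
apply: le_trans (normal_mean_vadd_ge s_gt0 d (q := PhiInv (p / N%:R)) tF _).
  by rewrite PhiE_le leeB// lee_fin.
have /andP[F0 F1] := randomized_test_mean_itv nv tF.
rewrite PhiE_PhiInv ge_max F0/= ge_min mean_label_frequency.
by rewrite ler_pM2r ?invr_gt0 ?ltr0n// p_le orbT.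
Qed.

Lemma sum_label_prob_shift_le t N x d p r : (0 < N)%N ->
  (forall w, count (mem (f w)) t <= N)%N -> norm2 d / s <= r ->
  \sum_(i <- t) label_prob s f x i <= p ->
  \sum_(i <- t) label_prob s f (vadd x d) i <=
  N%:R * PhiE (PhiInv (p / N%:R) + r%:E).
Proof.
move=> N0 tN dr p_ge.
have tF := randomized_test_vadd x (randomized_test_label_frequency N0 tN).
rewrite [leRHS]mulrC -ler_pdivrMr ?ltr0n// -mean_label_frequency.
under eq_Rintegral do rewrite vaddA.
apply: le_trans (normal_mean_vadd_le s_gt0 d (q := PhiInv (p / N%:R)) tF _) _.
  have /andP[F0 F1] := randomized_test_mean_itv nv tF.
  rewrite PhiE_PhiInv le_max le_min F1 mean_label_frequency.
  by rewrite ler_pM2r ?invr_gt0 ?ltr0n// p_ge orbT.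
by rewrite PhiE_le leeD// lee_fin.
Qed.

Lemma average_label_prob_shift_ge t N x d p r tau :
  (0 < N)%N -> (0 < size t)%N ->
  (forall w, count (mem (f w)) t <= N)%N -> norm2 d / s <= r ->
  p <= \sum_(i <- t) label_prob s f x i ->
  {in t, forall i, label_prob s f (vadd x d) i <= tau} ->
  N%:R / (size t)%:R * PhiE (PhiInv (p / N%:R) - r%:E) <= tau.
Proof.
move=> N0 t0 tN dr p_le t_tau; rewrite mulrAC ler_pdivrMr ?ltr0n//.
apply: le_trans (sum_label_prob_shift_ge N0 tN dr p_le) _.
rewrite mulr_natr -iter_addr_0 -count_predT -big_const_seq.
exact: ler_sum_in.
Qed.

Lemma average_label_prob_shift_le t N x d p r tau :
  (0 < N)%N -> (0 < size t)%N ->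
  (forall w, count (mem (f w)) t <= N)%N -> norm2 d / s <= r ->
  \sum_(i <- t) label_prob s f x i <= p ->
  {in t, forall i, tau <= label_prob s f (vadd x d) i} ->
  tau <= N%:R / (size t)%:R * PhiE (PhiInv (p / N%:R) + r%:E).
Proof.
move=> N0 t0 tN dr p_ge t_tau; rewrite mulrAC ler_pdivlMr ?ltr0n//.
apply: le_trans (sum_label_prob_shift_le N0 tN dr p_ge).
rewrite mulr_natr -iter_addr_0 -count_predT -big_const_seq.
exact: ler_sum_in.
Qed.

End label_probabilities.

Lemma topk_threshold (R : realType) c (p : 'I_c -> R) k (G : {set 'I_c}) :
  (forall i, 0 <= p i) -> is_topk p k G ->
  exists tau, (forall i, i \notin G -> p i <= tau) /\
              {in G, forall j, tau <= p j}.
Proof.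
move=> p0 [_ topG]; exists (\big[Num.max/0]_(i | i \notin G) p i); split=> i iG.
  exact: le_bigmax_cond.
by apply: bigmax_le => // j jG; exact: topG.
Qed.

(* Ranks are counted from 1. *)
Definition ranked_value (R : realType) (I : Type) (v : I -> R) (t : seq I)
    (l : nat) : R :=
  nth 0 (map v t) l.-1.

Lemma pA_ranked_value (R : realType) (I : Type) (v : I -> R) (t : seq I) i u :
  pA (ranked_value v t) i.+1 u = \sum_(i <= l < i + u) nth 0 (map v t) l.
Proof. by rewrite /pA big_add1. Qed.

Lemma pB_ranked_value (R : realType) (I : Type) (v : I -> R) (t : seq I)
    k e' n :
  (n <= (k - e').+1)%N ->
  pB k (ranked_value v t) e' n =
  \sum_((k - e').+1 - n <= l < (k - e').+1 - n + n) nth 0 (map v t) l.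
Proof. by move=> nk; rewrite /pB big_add1 subnK. Qed.

Section certificate.
Context {R : realType} (s : R) (m c : nat) (f : m.-tuple R -> {set 'I_c}).
Hypothesis s_gt0 : 0 < s.
Hypothesis mf : forall i, measurable [set w : m.-tuple R | i \in f w].
Variables (x d : m.-tuple R) (r tau : R) (L G : {set 'I_c}) (k e' : nat).
Hypothesis d_le_r : norm2 d / s <= r.
Hypothesis overlap_lt : (#|L :&: G| < e')%N.
Local Notation p := (label_prob s f x).
Local Notation pd := (label_prob s f (vadd x d)).

Lemma missed_labels_le_tau (plo : 'I_c -> R) (a : seq 'I_c) u N :
  perm_eq a (enum L) -> sorted (fun i j => plo j <= plo i) a ->
  {in L, forall i, plo i <= p i} -> (forall i, i \notin G -> pd i <= tau) ->
  (0 < u)%N -> (e' + u <= #|L|.+1)%N ->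
  (0 < N)%N -> (forall w, minn u #|f w| <= N)%N ->
  N%:R / u%:R * PhiE (PhiInv (pA (ranked_value plo a) e' u / N%:R) - r%:E)
    <= tau.
Proof.
move=> aL sa plo_p pd_tau u0 e'u N0 fN; pose A := [seq i <- a | i \notin G].
have ua : uniq a by rewrite (perm_uniq aL) enum_uniq.
have sza : size a = #|L| by rewrite (perm_size aL) -cardE.
have szA : (size A + #|L :&: G| = #|L|)%N.
  rewrite -(cardsID G L) addnC -(card_uniqP (filter_uniq _ ua)).
  congr (_ + _)%N.
  by apply: eq_card => i; rewrite mem_filter (perm_mem aL) mem_enum !inE.
have uA : (u <= size A)%N by move: szA overlap_lt e'u; clear; lia.
have szt : size (take u A) = u by rewrite size_takel.
have t_sub i : i \in take u A -> (i \notin G) && (i \in L).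
  by move=> /mem_take; rewrite mem_filter (perm_mem aL) mem_enum.
have ranked_le : pA (ranked_value plo a) e' u <= \sum_(i <- take u A) plo i.
  case: e' overlap_lt e'u => // i iL iu; rewrite pA_ranked_value.
  apply: sum_take_subseq_ge => //; first exact: filter_subseq.
  - by rewrite sza -szA addKn.
  - by rewrite sza.
rewrite -[in u%:R]szt.
apply: (average_label_prob_shift_ge s_gt0 mf N0 _ _ d_le_r).
- by rewrite szt.
- move=> w; apply: leq_trans (fN w); rewrite -[X in minn X _]szt.
  by apply: count_mem_uniq; rewrite take_uniq// filter_uniq.
- apply/(le_trans ranked_le)/ler_sum_in => i /t_sub/andP[_ iL].
  exact: plo_p.
- by move=> i /t_sub/andP[iG _]; exact: pd_tau.
Qed.

Lemma tau_le_intruding_labels (pup : 'I_c -> R) (b : seq 'I_c) n N :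
  perm_eq b (enum (~: L)) -> sorted (fun i j => pup j <= pup i) b ->
  (forall j, j \notin L -> p j <= pup j) -> {in G, forall j, tau <= pd j} ->
  #|G| = k -> (e' <= k)%N ->
  (0 < n)%N -> (n <= (k - e').+1)%N ->
  (0 < N)%N -> (forall w, minn n #|f w| <= N)%N ->
  tau <=
  N%:R / n%:R * PhiE (PhiInv (pB k (ranked_value pup b) e' n / N%:R) + r%:E).
Proof.
move=> bL sb p_pup tau_pd cG e'k n0 nk N0 fN; pose B := [seq j <- b | j \in G].
have ub : uniq b by rewrite (perm_uniq bL) enum_uniq.
have szB : (size B + #|L :&: G| = k)%N.
  rewrite -cG -(cardsID L G) finset.setIC addnC.
  rewrite -(card_uniqP (filter_uniq _ ub)); congr (_ + _)%N.
  by apply: eq_card => j; rewrite mem_filter (perm_mem bL) mem_enum !inE andbC.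
pose t := take n (drop ((k - e').+1 - n) B).
have nB : ((k - e').+1 - n + n <= size B)%N.
  by move: szB overlap_lt e'k nk; clear; lia.
have szt : size t = n by rewrite size_takel// size_drop; move: nB; clear; lia.
have t_sub j : j \in t -> (j \in G) && (j \notin L).
  by move=> /mem_take/mem_drop; rewrite mem_filter (perm_mem bL) mem_enum inE.
have le_ranked : \sum_(j <- t) pup j <= pB k (ranked_value pup b) e' n.
  rewrite pB_ranked_value//.
  by apply: sum_window_subseq_le => //; exact: filter_subseq.
rewrite -[in n%:R]szt.
apply: (average_label_prob_shift_le s_gt0 mf N0 _ _ d_le_r).
- by rewrite szt.
- move=> w; apply: leq_trans (fN w); rewrite -[X in minn X _]szt.
  by apply: count_mem_uniq; rewrite take_uniq// drop_uniq// filter_uniq.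
- apply: le_trans le_ranked; apply: ler_sum_in => j /t_sub/andP[_ jL].
  exact: p_pup.
- by move=> j /t_sub/andP[jG _]; exact: tau_pd.
Qed.

Variable N : nat.
Hypothesis N_gt0 : (0 < N)%N.
Hypothesis card_f : forall w, #|f w| = N.

Lemma certificate_lower_le_tau (plo : 'I_c -> R) (a : seq 'I_c) :
  let pa := ranked_value plo a in
  perm_eq a (enum L) -> sorted (fun i j => plo j <= plo i) a ->
  {in L, forall i, plo i <= p i} -> (forall i, i \notin G -> pd i <= tau) ->
  (e' <= #|L|)%N ->
  \big[Num.max/PhiE (PhiInv (pa e') - r%:E)]_(1 <= u < (#|L| - e').+2)
    (N%:R / u%:R * PhiE (PhiInv (pA pa e' u / N%:R) - r%:E)) <= tau.
Proof.
move=> pa aL sa plo_p pd_tau e'L; rewrite big_nat.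
apply: bigmax_le => [|u /andP[u0 ue]].
  have := @missed_labels_le_tau plo a 1 1 aL sa plo_p pd_tau isT.
  rewrite addn1 ltnS /pA addn1 big_nat1 !divr1 mul1r; apply=> // w.
  exact: geq_minl.
apply: missed_labels_le_tau => //; first by move: ue e'L; clear; lia.
by move=> w; rewrite card_f geq_minr.
Qed.

Lemma tau_le_certificate_upper (pup : 'I_c -> R) (b : seq 'I_c) :
  let pb := ranked_value pup b in
  perm_eq b (enum (~: L)) -> sorted (fun i j => pup j <= pup i) b ->
  (forall j, j \notin L -> p j <= pup j) -> {in G, forall j, tau <= pd j} ->
  #|G| = k -> (e' <= k)%N ->
  tau <=
  \big[Num.min/PhiE (PhiInv (pb (k - e').+1) + r%:E)]_(1 <= v < (k - e').+2)
    (N%:R / v%:R * PhiE (PhiInv (pB k pb e' v / N%:R) + r%:E)).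
Proof.
move=> pb bL sb p_pup tau_pd cG e'k; rewrite big_nat.
apply: le_bigmin => [|v /andP[v0 ve]].
  have := tau_le_intruding_labels (N := 1) bL sb p_pup tau_pd cG e'k
    (n := 1) isT isT isT.
  rewrite /pB subn1 big_nat1 !divr1 mul1r; apply=> w.
  exact: geq_minl.
by apply: tau_le_intruding_labels => // w; rewrite card_f geq_minr.
Qed.

End certificate.

Theorem theorem1 (R : realType) (m c : nat) (f : m.-tuple R -> {set 'I_c})
    (kp k : nat) (sigma : R) (x : m.-tuple R) (L : {set 'I_c})
    (plo pup : 'I_c -> R) (a b : seq 'I_c) (rad : R) :
  (1 <= c)%N ->
  (forall i : 'I_c, measurable [set w : m.-tuple R | i \in f w]) ->
  (forall w, #|f w| = kp) ->
  (1 <= kp <= c)%N -> (1 <= k <= c)%N -> 0 < sigma ->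
  (1 <= #|L|)%N ->
  (forall i, i \in L -> 0 <= plo i <= 1 /\ plo i <= label_prob sigma f x i) ->
  (forall j, j \notin L -> 0 <= pup j <= 1 /\ label_prob sigma f x j <= pup j) ->
  perm_eq a (enum L) -> sorted (fun i j => plo j <= plo i) a ->
  perm_eq b (enum (~: L)) -> sorted (fun i j => pup j <= pup i) b ->
  let pa := fun l : nat => nth 0 (map plo a) l.-1 in
  let pb := fun l : nat => nth 0 (map pup b) l.-1 in
  (forall e' : nat, (1 <= e' <= minn #|L| k)%N ->
     forall v : nat, (1 <= v <= (k - e').+1)%N -> pB k pb e' v <= kp%:R) ->
  0 <= rad ->
  forall delta : m.-tuple R, norm2 delta <= rad ->
  forall G : {set 'I_c}, is_topk (label_prob sigma f (vadd x delta)) k G ->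
  (cert_e sigma rad kp k #|L| pa pb <= #|L :&: G|)%N.
Proof.
move=> _ mf fkp /andP[kp_gt0 _] _ s_gt0 _ plo_le le_pup aL sa bL sb pa pb _ _.
move=> delta delta_rad G topG.
apply/bigmax_leqP_seq => e'; rewrite mem_index_iota ltnS leq_min.
move=> /andP[_ /andP[e'L e'k]]; apply: contraTT.
rewrite -ltnNge -leNgt => overlap_lt.
have dr : norm2 delta / sigma <= rad / sigma by rewrite ler_pM2r ?invr_gt0.
have [tau [outside_tau tau_inside]] :=
  topk_threshold (label_prob_ge0 sigma mf (vadd x delta)) topG.
apply: (@le_trans _ _ tau).
- apply: (certificate_lower_le_tau (x := x) s_gt0 mf dr overlap_lt kp_gt0 fkp
    aL sa) => //.
  by move=> i /plo_le[].
- apply: (tau_le_certificate_upper (x := x) s_gt0 mf dr overlap_lt kp_gt0 fkp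
    bL sb) => //.
    by move=> j /le_pup[].
  by case: topG.
Qed.
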